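(* Let $\Delta\ge1$ be an integer. There exists a unique $C=C_{\Delta,1}>0$ such that the ODE $$\dot F(z)=C\,\big(1-F^{\Delta+1}(z)\big)^{\Delta/(\Delta+1)},\qquad z\in(0,\infty),$$ with boundary conditions $$F(0)=0\quad\text{and}\quad \inf\{t>0: F(t)=1\}=1,$$ has a solution. Moreover, with $C=C_{\Delta,1}$, this ODE with these boundary conditions has a unique solution $\bar F_{\Delta,1}$. Furthermore $\bar F_{\Delta,1}=F_{\Delta,1}$, where $F_{\Delta,1}$ is the limiting root-marginal distribution function of the continuous hardcore model with activity $\lambda=1$ (defined in the context).
   Context: A solution of the ODE is a continuous function $F:[0,\infty)\to[0,1]$ that is differentiable on $(0,\infty)$ and satisfies the ODE there; the infimum of the empty set is $+\infty$. For integers $\Delta\ge1$, $n\ge0$, $\mathbb{T}_{n,\Delta}$ is the rooted tree of depth $n$ in which every node at distance less than $n$ from the root has exactly $\Delta$ children; its leaf set $\partial\mathbb{T}_{n,\Delta}$ is the set of nodes at distance $n$ from the root. For a finite simple graph $\mathbb{G}=(V,E)$ let $\mathcal{P}(\mathbb{G})=\{\mathbf{x}\in\mathbb{R}^V: x_u\ge0\ \forall u,\ x_u+x_v\le1\ \forall (u,v)\in E\}$. For a finite Borel measure $\mu$ on $[0,1]$ the hardcore model on $\mathbb{G}$ with free spin measure $\mu$ is $\mathbb{P}_{\mathbb{G},\mu}(A)=\mu^{\otimes V}(A)/\mu^{\otimes V}(\mathcal{P}(\mathbb{G}))$, $A\subset\mathcal{P}(\mathbb{G})$ Borel. The continuous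 hardcore model with activity $\lambda=1$ has $\mu=\nu_1=$ Lebesgue measure on $[0,1]$ (so it is the uniform distribution on $\mathcal{P}(\mathbb{G})$ when every vertex has an edge). $F_{n,\Delta,1}(\cdot\,|\,\mathbf{x})$ is the cumulative distribution function of the spin at the root of $\mathbb{T}_{n,\Delta}$ under the continuous hardcore model with $\lambda=1$, conditioned on the leaf spins being $\mathbf{x}\in[0,1]^{\partial\mathbb{T}_{n,\Delta}}$. Explicitly, with $\mu=\nu_1$, $z\in[0,1]$: for $n=1$ and $\bar x=\max_i x_i$, $F_1(z|\mathbf{x})=\mu[0,\min(z,1-\bar x)]/\mu[0,1-\bar x]$ if $\bar x<1$, and $F_1(z|\mathbf{x})=1$ if $\bar x=1$; for $n\ge2$, $F_n(z|\mathbf{x})=\int_{[0,z]}\prod_{i=1}^\Delta F_{n-1}(1-t|\mathbf{x}^i)\mu(dt)\big/\int_{[0,1]}\prod_{i=1}^\Delta F_{n-1}(1-t|\mathbf{x}^i)\mu(dt)$, where $\mathbf{x}^i$ is the restriction of $\mathbf{x}$ to the leaves of the subtree rooted at the $i$-th child of the root. It is known that there is a (necessarily unique) function $F_{\Delta,1}$ on $[0,1]$ with $\lim_{n\to\infty}\sup_{\mathbf{x}}\sup_{z\in[0,1]}|F_{n,\Delta,1}(z|\mathbf{x})-F_{\Delta,1}(z)|=0$, the supremum being over all $\mathbf{x}\in[0,1]^{\partial\mathbb{T}_{n,\Delta}}$; as a distribution function it is extended by $F_{\Delta,1}(z)=1$ for $z\ge1$. *)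

(* Defs.v *)
From HB Require Import structures.
From mathcomp Require Import all_boot all_order all_algebra.
From mathcomp Require Import all_classical all_reals all_analysis.

Set Implicit Arguments.
Unset Strict Implicit.
Unset Printing Implicit Defensive.

Import Order.TTheory GRing.Theory Num.Theory.
Import numFieldNormedType.Exports.

Local Open Scope classical_set_scope.
Local Open Scope ring_scope.

(* A leaf of the Delta-ary tree of depth n is encoded by the sequence of child
   indices followed from the root, so that the configurations on the leaf set
   are the functions n.-tuple 'I_Delta -> R. *)
Definition leaf_spins (R : realType) (Delta n : nat) : Type :=
  n.-tuple 'I_Delta -> R.

Definition child_spins (R : realType) (Delta n : nat)
    (x : leaf_spins R Delta n.+1) (i : 'I_Delta) : leaf_spins R Delta n :=
  fun p => x [tuple of i :: p].

Definition nu1 (R : realType) : {measure set (measurableTypeR R) -> \bar R} :=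
  mrestr (@lebesgue_measure R) (measurable_itv `[0%R, 1%R]).

(* F_1(z | x); the neutral element 0 of the maximum is harmless since it is
   only used for Delta >= 1 and spins in [0, 1]. *)
Definition root_cdf1 (R : realType)
    (mu : {measure set (measurableTypeR R) -> \bar R}) (Delta : nat)
    (x : leaf_spins R Delta 1) (z : R) : R :=
  let xbar := \big[Num.max/0]_(i < Delta) x [tuple i] in
  if xbar < 1 then
    fine (mu `[0, Num.min z (1 - xbar)]%classic) / fine (mu `[0, 1 - xbar]%classic)
  else 1.

(* F_n(z | x), meaningful for n >= 1 and z in [0, 1].  At n = 0 the root is
   itself a leaf and the value is the distribution function of its
   prescribed spin; it does not enter the recursion. *)
Fixpoint root_cdf (R : realType)
    (mu : {measure set (measurableTypeR R) -> \bar R}) (Delta n : nat) :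
    leaf_spins R Delta n -> R -> R :=
  match n with
  | 0 => fun x z => if x [tuple] <= z then 1 else 0
  | m.+1 =>
    match m as k return
      (leaf_spins R Delta k -> R -> R) -> leaf_spins R Delta k.+1 -> R -> R with
    | 0 => fun _ x z => root_cdf1 mu x z
    | k.+1 => fun F x z =>
      (\int[mu]_(t in `[0, z]%classic) \prod_(i < Delta) F (child_spins x i) (1 - t))
      / (\int[mu]_(t in `[0, 1]%classic) \prod_(i < Delta) F (child_spins x i) (1 - t))
    end (@root_cdf R mu Delta m)
  end.

(* F is the limiting root marginal F_{Delta,1}, extended by 1 on [1, +oo[.
   Its values on ]-oo, 0[ are left unconstrained. *)
Definition is_limit_root_cdf (R : realType) (Delta : nat) (F : R -> R) : Prop :=
  (fun n : nat =>
     ereal_sup [set ereal_sup [set `|root_cdf (nu1 R) x z - F z|%:E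
                              | z in `[0%R, 1%R]]
               | x in [set x : leaf_spins R Delta n |
                       forall p, 0 <= x p <= 1]]) @ \oo --> 0%E
  /\ forall z : R, 1 <= z -> F z = 1.

(* Functions on [0, +oo[ are represented by functions on R whose values on
   ]-oo, 0[ are irrelevant. *)
Definition ode_solution (R : realType) (Delta : nat) (C : R) (F : R -> R) : Prop :=
  [/\ forall z : R, 0 <= z -> 0 <= F z <= 1,
      {within `[0, +oo[, continuous F} &
      forall z : R, 0 < z ->
        derivable F z 1 /\
        F^`()%classic z = C * (1 - F z ^+ Delta.+1) `^ (Delta%:R / Delta.+1%:R)].

Definition boundary_conditions (R : realType) (F : R -> R) : Prop :=
  F 0 = 0 /\ ereal_inf [set t%:E | t in [set t : R | 0 < t /\ F t = 1]] = 1%E.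

Definition bvp_solution (R : realType) (Delta : nat) (C : R) (F : R -> R) : Prop :=
  ode_solution Delta C F /\ boundary_conditions F.

(* Main.v *)
Require Import Defs.
From HB Require Import structures.
From mathcomp Require Import all_boot all_order all_algebra.
From mathcomp Require Import all_classical all_reals all_analysis.
From mathcomp Require Import ring lra.

(** Write p = Delta + 1. Along a solution F put G = (1 - F^p)^(1/p). The
    differential equation becomes the autonomous system
      F' = C G^Delta,   G' = - C F^Delta,
    a motion along the curve F^p + G^p = 1 that must go from (0, 1) to (1, 0)
    in exactly unit time. Up to the factor C this motion is unique, so the
    boundary conditions fix C, and then F.

    Separating variables in F would produce a time integral that is singular
    at F = 1. Instead the curve is parametrised by s = F / (F + G), that is, by
    the radial projection of the point (s, 1 - s) of a line. As
    F' G - F G' = C (F^p + G^p) = C, the time differential becomes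
      C dz = ds / (s^p + (1 - s)^p)^(2/p),
    whose density is positive and continuous on the whole real line. Its
    primitive Z with Z(0) = 0 gives Z(s(z)) = C z, hence C = Z(1)
    ([flow_unique]); conversely, projecting the inverse of Z gives a
    solution ([quarter_wave_bvp]), which stays differentiable when it is
    continued by 1 because F' = C G^Delta vanishes at (1, 0).

    For the hardcore model, the leaf spins are set to 0 at every depth. The
    root distribution functions F_n then satisfy
      F_(n+1)(z) = int_0^z F_n(1-t)^Delta dt / int_0^1 F_n(1-t)^Delta dt,
    and uniform convergence carries this over to the limit F
    ([limit_fixpoint]). Hence F'(z) = C F(1-z)^Delta, so that F and
    G(z) = F(1-z) satisfy the system above; F(z)^p + F(1-z)^p is constant,
    equal to its value 1 at z = 0, and [flow_unique] identifies F with the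
    solution already found ([limit_eq_quarter_wave]). *)

Set Implicit Arguments.
Unset Strict Implicit.
Unset Printing Implicit Defensive.

Import Order.TTheory GRing.Theory Num.Theory.
Import numFieldNormedType.Exports.

Local Open Scope classical_set_scope.
Local Open Scope ring_scope.

(** * Primitives of positive functions and their inverses *)

Section Clock.
Variable R : realType.
Implicit Types (f g k : R -> R).

Lemma is_derive_continuous f (x d : R) :
  is_derive x 1 f d -> {for x, continuous f}.
Proof. by move=> [df _]; exact/differentiable_continuous/derivable1_diffP. Qed.

Lemma continuous_itv_integrable f (a b : R) : continuous f ->
  (@lebesgue_measure R).-integrable `[a, b] (EFin \o f).
Proof.
move=> cf; apply: continuous_compact_integrable; first exact: segment_compact.
exact: continuous_subspaceT.
Qed.

(** The base point -1 makes every point of [0, 1], the end points included,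
    interior to the domain on which the primitive is differentiable. *)
Definition primitive f (x : R) : R :=
  \int[lebesgue_measure]_(t in `[-1, x]) f t.

Lemma is_derive_primitive f (x : R) : continuous f -> -1 < x ->
  is_derive x 1 (primitive f) (f x).
Proof.
move=> cf x1; have xx1 : x < x + 1 by rewrite ltrDl.
have [|? <-] := continuous_FTC1_closed xx1 _ x1 (cf x).
  exact: continuous_itv_integrable.
by rewrite derive1E; exact/derivableP.
Qed.

Lemma Rintegral_primitive f (z : R) : continuous f -> 0 <= z ->
  \int[lebesgue_measure]_(t in `[0, z]) f t = primitive f z - primitive f 0.
Proof.
move=> cf z0.
have int := continuous_itv_integrable (-1) z cf.
rewrite /primitive (Rintegral_itvB int) ?bnd_simp ?lerN10//.
rewrite Rintegral_itv_obnd_cbnd//.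
apply: integrableS (continuous_itv_integrable 0 z cf) => //.
exact: subset_itv_oc_cc.
Qed.

(** Integrating the positive density [k] gives a strictly increasing [Z], and
    [S] is its inverse. The inverse function theorem applies at the end points
    of [0, Z 1] as well, because [k] is positive on both sides of 0 and 1;
    two-sided differentiability at [Z 1] is what allows the solution to be
    continued beyond time 1. *)
Lemma primitive_inverse k : continuous k -> (forall u, 0 < k u) ->
  exists Z S : R -> R,
    [/\ Z 0 = 0, 0 < Z 1, forall u : R, -1 < u -> is_derive u 1 Z (k u),
        forall u : R, 0 <= u <= 1 -> S (Z u) = u &
        forall y : R, 0 <= y <= Z 1 ->
          [/\ 0 <= S y <= 1, Z (S y) = y & is_derive y 1 S (k (S y))^-1]].
Proof.
move=> ck k0.
pose Z x := primitive k x - primitive k 0.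
have dZ (u : R) : -1 < u -> is_derive u 1 Z (k u).
  move=> u1; have dP := is_derive_primitive ck u1.
  have /= := @is_deriveB _ _ _ _ _ _ _ _ _ dP
    (is_derive_cst (primitive k 0) u 1).
  by rewrite subr0.
have incZ (u v : R) : -1 < u -> u < v -> Z u < Z v.
  move=> u1 uv; have vin : forall w : R, w \in `]u, v[ -> -1 < w.
    by move=> w; rewrite in_itv/= => /andP[+ _]; exact: lt_trans.
  have [w wuv||c _ Zvu] := MVT uv (df := k) (f := Z).
  - by apply: dZ; exact: vin.
  - apply: continuous_in_subspaceT => w; rewrite inE/= in_itv/= => /andP[uw _].
    by apply: is_derive_continuous; apply: dZ; exact: lt_le_trans uw.
  - by rewrite -subr_gt0 Zvu mulr_gt0// subr_gt0.
have Z0 : Z 0 = 0 by rewrite /Z subrr.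
have injZ (u v : R) : -1 < u -> -1 < v -> Z u = Z v -> u = v.
  move=> u1 v1 Zuv; have [uv|vu|//] := ltgtP u v.
    by have := incZ _ _ u1 uv; rewrite Zuv ltxx.
  by have := incZ _ _ v1 vu; rewrite Zuv ltxx.
(* Z need not be surjective: outside its range S takes the default value. *)
pose S y := xget 0 [set u | -1 < u /\ Z u = y].
have SZ (u : R) : -1 < u -> S (Z u) = u.
  move=> u1; rewrite /S; case: xgetP => [v _ [v1 Zv]|/(_ u) []//].
  exact: injZ.
have cZ (u : R) : -1 < u -> {for u, continuous Z}.
  by move=> u1; apply: is_derive_continuous; exact: dZ.
exists Z, S; split => //.
- by rewrite -Z0; apply: incZ; rewrite ?ltr01// ltrN10.
- by move=> u /andP[u0 _]; apply: SZ; rewrite (lt_le_trans _ u0)// ltrN10.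
move=> y /andP[y0 y1].
have [||u /[!in_itv]/= /andP[u0 u1] Zu] := @IVT R Z 0 1 y ler01.
- apply: continuous_in_subspaceT => w; rewrite inE/= in_itv/= => /andP[w0 _].
  by apply: cZ; rewrite (lt_le_trans _ w0)// ltrN10.
- by rewrite Z0 ge_min y0/= le_max y1 orbT.
have u_gtN1 : -1 < u by rewrite (lt_le_trans _ u0)// ltrN10.
rewrite -Zu SZ//; split => //; first by rewrite u0 u1.
have nearu : \forall v \near u, -1 < v by exact: lt_nbhsr.
apply: is_derive_inverse.
- by apply: filterS nearu => v; exact: SZ.
- by apply: filterS nearu => v; exact: cZ.
- exact: dZ.
- by rewrite gt_eqF.
Qed.

End Clock.

(** * The root of order D + 1 *)

Section Root.
Variables (R : realType) (D : nat).
Implicit Types x : R.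

Definition rootS x : R := x `^ (D.+1%:R)^-1.

Lemma rootS_ge0 x : 0 <= rootS x. Proof. exact: powR_ge0. Qed.

Lemma rootS_gt0 x : 0 < x -> 0 < rootS x. Proof. exact: powR_gt0. Qed.

Lemma rootSK x : 0 <= x -> rootS x ^+ D.+1 = x.
Proof.
move=> x0.
by rewrite -powR_mulrn ?rootS_ge0// -powRrM mulVf ?pnatr_eq0// powRr1.
Qed.

Lemma exprSK x : 0 <= x -> rootS (x ^+ D.+1) = x.
Proof.
by move=> x0; rewrite /rootS -powR_mulrn// -powRrM divff ?pnatr_eq0// powRr1.
Qed.

Lemma powR_fracE x : 0 <= x -> x `^ (D%:R / D.+1%:R) = rootS x ^+ D.
Proof. by move=> x0; rewrite mulrC powRrM powR_mulrn// rootS_ge0. Qed.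

Lemma is_derive_rootS (f : R -> R) (x df : R) : 0 < f x -> is_derive x 1 f df ->
  is_derive x 1 (fun y => rootS (f y)) (df / (D.+1%:R * rootS (f x) ^+ D)).
Proof.
move=> fx0 dfx.
have := is_derive1_comp (is_derive1_powR (D.+1%:R)^-1 fx0) dfx.
move/is_derive_eq; apply.
rewrite powRB; last by rewrite (gt_eqF fx0) implybT.
rewrite -/(rootS (f x)) (powRr1 (ltW fx0)) -{2}(rootSK (ltW fx0)) exprS.
have r0 : rootS (f x) != 0 by rewrite gt_eqF ?rootS_gt0.
have p0 : D.+1%:R != 0 :> R by rewrite pnatr_eq0.
by field; rewrite r0 addrC natr1 p0 expf_neq0.
Qed.

End Root.

(** * Radial parametrisation of the curve F^p + G^p = 1 *)

Section Curve.
Variables (R : realType) (D : nat).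
Implicit Types s : R.
Notation p := (D.+1).

(** The p-th power of the p-norm of the point (s, 1 - s) of the simplex line,
    without absolute values so that it is a polynomial in s. *)
Definition pnormX s : R := s ^+ p + (1 - s) ^+ p.

(** Outside [0, 1] and for odd exponents one of the two powers is negative; the
    sum is still positive because the larger of [s] and [1 - s] is also
    the larger in absolute value. *)
Lemma pnormX_gt0 s : 0 < pnormX s.
Proof.
wlog s1 : s / 1 - s <= s.
  move=> h; have [s1|/ltW s1] := leP (1 - s) s; first exact: h.
  suff : 0 < pnormX (1 - s) by rewrite /pnormX subKr addrC.
  by apply: h; rewrite subKr.
have s0 : 0 < s by lra.
rewrite /pnormX; have [s2|s2] := leP 0 (1 - s).
  by rewrite ltr_wpDr ?exprn_gt0// exprn_ge0.
rewrite -ltrBlDr sub0r (le_lt_trans (ler_norm _))// normrN normrX.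
by rewrite ltrXn2r// ler0_norm ?ltW//; lra.
Qed.

Definition pnorm s : R := rootS D (pnormX s).

Lemma pnorm_gt0 s : 0 < pnorm s.
Proof. exact/rootS_gt0/pnormX_gt0. Qed.

(** First coordinate of the radial projection of (s, 1 - s) to the curve
    F^p + G^p = 1; the second coordinate is [radial (1 - s)]. *)
Definition radial s : R := s / pnorm s.

Lemma radial0 : radial 0 = 0. Proof. by rewrite /radial mul0r. Qed.

Lemma radial1 : radial 1 = 1.
Proof.
by rewrite /radial /pnorm /pnormX subrr expr0n addr0 expr1n /rootS powR1 divr1.
Qed.

Lemma radial_expD s : radial s ^+ p + radial (1 - s) ^+ p = 1.
Proof.
rewrite /radial {2}/pnorm /pnormX subKr addrC -/(pnormX s).
rewrite addrC [X in rootS _ X]addrC -/(pnormX s) -/(pnorm s).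
rewrite !expr_div_n -mulrDl rootSK ?ltW ?pnormX_gt0// -/(pnormX s).
by rewrite divff// gt_eqF// pnormX_gt0.
Qed.

Lemma is_derive_pnormX s :
  is_derive s 1 pnormX (p%:R * (s ^+ D - (1 - s) ^+ D)).
Proof.
have d1 := is_deriveX p (is_derive_id s (1 : R)).
have d2 := is_deriveX p
  (is_deriveB (is_derive_cst (1 : R) s (1 : R)) (is_derive_id s (1 : R))).
have -> : pnormX = (id ^+ p) + ((cst (1 : R) - id) ^+ p).
  by apply/funext => y; rewrite fctE /= !fctE.
apply: (is_derive_eq (is_deriveD d1 d2)).
rewrite /= !fctE /= /GRing.scale /=; ring.
Qed.

Lemma is_derive_pnorm s :
  is_derive s 1 pnorm ((s ^+ D - (1 - s) ^+ D) / pnorm s ^+ D).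
Proof.
apply: (is_derive_eq
  (@is_derive_rootS R D _ _ _ (pnormX_gt0 s) (is_derive_pnormX s))).
rewrite -/(pnorm s) -mulf_div divff ?pnatr_eq0// mul1r//.
Qed.

(** Divided by [pnorm s ^- 2], the density of the clock, the velocity becomes
    the D-th power of the second coordinate: this is the equation F' = G^D in
    the time measured by the clock. *)
Lemma is_derive_radial s :
  is_derive s 1 radial (radial (1 - s) ^+ D / pnorm s ^+ 2).
Proof.
have N0 : pnorm s != 0 by rewrite gt_eqF// pnorm_gt0.
have dV := is_deriveV N0 (is_derive_pnorm s).
apply: (is_derive_eq (is_deriveM (is_derive_id s (1 : R)) dV)).
rewrite /GRing.scale /= /radial.
have -> : pnorm (1 - s) = pnorm s by rewrite /pnorm /pnormX subKr addrC.
have := rootSK D (ltW (pnormX_gt0 s)); rewrite -/(pnorm s) /pnormX !exprS => NE.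
rewrite expr_div_n mulr1.
have ND0 : pnorm s ^+ D != 0 by rewrite expf_neq0.
apply: (mulfI (mulf_neq0 N0 N0)); apply: (mulfI ND0).
transitivity (pnorm s * pnorm s ^+ D - s * s ^+ D + s * (1 - s) ^+ D).
  by field; rewrite N0 ND0.
by rewrite NE; field; rewrite N0 ND0.
Qed.

End Curve.

(** * Uniqueness of the motion along the curve *)

Section Flow.
Variables (R : realType) (D : nat).
Notation p := (D.+1).
Implicit Types (F G Z S : R -> R) (C : R).

(** [Z s] is the time that the motion with C = 1 takes from (0, 1) to the
    projection of (s, 1 - s), and [S] recovers s from that time; [Z 1] is the
    time of the whole quarter curve. *)
Definition clock Z S : Prop :=
  [/\ Z 0 = 0, 0 < Z 1,
      forall u : R, -1 < u -> is_derive u 1 Z (pnorm D u ^- 2),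
      forall u : R, 0 <= u <= 1 -> S (Z u) = u &
      forall y : R, 0 <= y <= Z 1 ->
        [/\ 0 <= S y <= 1, Z (S y) = y & is_derive y 1 S (pnorm D (S y) ^+ 2)]].

Lemma clock_exists : exists Z S, clock Z S.
Proof.
have N0 (u : R) : pnorm D u != 0 by rewrite gt_eqF ?pnorm_gt0.
have ck : continuous (fun u : R => pnorm D u ^- 2).
  move=> u; apply: (@continuousV _ _ (fun u => pnorm D u ^+ 2)).
    by rewrite expf_neq0.
  apply: (@continuous_comp _ _ _ (pnorm D) (fun x => x ^+ 2)).
    exact: is_derive_continuous (is_derive_pnorm D u).
  exact: exprn_continuous.
have k0 (u : R) : 0 < pnorm D u ^- 2 by rewrite invr_gt0 exprn_gt0 ?pnorm_gt0.
have [Z [S [Z0 Z1 dZ SZ ZS]]] := primitive_inverse ck k0.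
exists Z, S; split => // y /ZS[S01 ZSy dS]; split => //.
by rewrite -[_ ^+ 2]invrK.
Qed.

Section Norm1.
Variables F G : R -> R.

(** The parameter of the point (F, G) of the curve: the inverse of the radial
    projection. *)
Definition simplex_coord z := F z / (F z + G z).

Variable z : R.
Hypotheses (F0 : 0 <= F z) (G0 : 0 <= G z) (FG1 : F z ^+ p + G z ^+ p = 1).

Lemma FG_gt0 : 0 < F z + G z.
Proof.
rewrite lt_def addr_ge0// andbT paddr_eq0//.
apply/negP => /andP[/eqP Fz /eqP Gz].
by move: FG1; rewrite Fz Gz expr0n/= addr0 => /eqP; rewrite eq_sym oner_eq0.
Qed.

Lemma simplex_coord01 : 0 <= simplex_coord z <= 1.
Proof.
rewrite /simplex_coord divr_ge0 ?addr_ge0//=.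
by rewrite ler_pdivrMr ?FG_gt0// mul1r lerDl.
Qed.

Lemma pnorm_simplex_coord : pnorm D (simplex_coord z) = (F z + G z)^-1.
Proof.
have H0 := FG_gt0.
have -> : pnorm D (simplex_coord z) = rootS D ((F z + G z)^-1 ^+ p).
  congr (rootS D _); rewrite /pnormX /simplex_coord.
  have -> : 1 - F z / (F z + G z) = G z / (F z + G z).
    by field; rewrite gt_eqF.
  by rewrite !expr_div_n -mulrDl FG1 mul1r exprVn.
by rewrite exprSK// invr_ge0 ltW.
Qed.

Lemma radial_simplex_coord : radial D (simplex_coord z) = F z.
Proof.
by rewrite /radial pnorm_simplex_coord invrK divfK// gt_eqF// FG_gt0.
Qed.

End Norm1.

(** With s = F / (F + G), the Wronskian F' G - F G' = C (F^p + G^p) = C gives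
    s' = C / (F + G)^2, while Z has derivative (F + G)^2 at s. So Z(s(z)) - C z
    has derivative 0 and stays equal to its value 0 at z = 0. At z = 1 the
    parameter is 1, which yields C = Z(1). *)
Lemma flow_unique Z S C F G : clock Z S ->
    {within `[0, 1], continuous F} -> {within `[0, 1], continuous G} ->
    (forall z : R, 0 <= z <= 1 ->
      [/\ 0 <= F z, 0 <= G z & F z ^+ p + G z ^+ p = 1]) ->
    (forall z : R, 0 < z < 1 -> is_derive z 1 F (C * G z ^+ D)) ->
    (forall z : R, 0 < z < 1 -> is_derive z 1 G (- (C * F z ^+ D))) ->
    F 0 = 0 -> F 1 = 1 ->
  C = Z 1 /\ forall z : R, 0 <= z <= 1 -> F z = radial D (S (Z 1 * z)).
Proof.
move=> [Z0 Z1 dZ SZ _] cF cG FG dF dG F0 F1.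
have sl01 (z : R) : 0 <= z <= 1 -> 0 <= simplex_coord F G z <= 1.
  by move=> /FG[? ? ?]; exact: simplex_coord01.
have sl_gt (z : R) : 0 <= z <= 1 -> -1 < simplex_coord F G z.
  by move=> /sl01 /andP[s0 _]; rewrite (lt_le_trans _ s0)// ltrN10.
pose h z := Z (simplex_coord F G z) - C * z.
have dh (z : R) : 0 < z < 1 -> is_derive z 1 h 0.
  move=> zo; have zc : 0 <= z <= 1 by case/andP: zo => /ltW-> /ltW->.
  have [Fz Gz FGz] := FG _ zc.
  have H0 := FG_gt0 Fz Gz FGz.
  have Hn0 : F z + G z != 0 by rewrite gt_eqF.
  have dV := is_deriveV (f := F + G) Hn0 (is_deriveD (dF _ zo) (dG _ zo)).
  have dsl := is_deriveM (dF _ zo) dV.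
  have dZs := is_derive1_comp (dZ _ (sl_gt _ zc)) dsl.
  have := is_deriveB dZs (is_deriveZ C (is_derive_id z (1 : R))).
  move/is_derive_eq; apply.
  rewrite pnorm_simplex_coord// /GRing.scale /= fctE exprVn invrK.
  have := FGz; rewrite !exprS => E.
  transitivity (C * (F z * F z ^+ D + G z * G z ^+ D) - C).
    by field.
  by rewrite E; ring.
have csl : {within `[0, 1], continuous (simplex_coord F G)}.
  move/subspace_continuousP : cF => cF; move/subspace_continuousP : cG => cG.
  apply/subspace_continuousP => z /= z01.
  have zc : 0 <= z <= 1 by rewrite in_itv/= in z01.
  have [Fz Gz FGz] := FG _ zc.
  apply: cvgM; first exact: cF.
  apply: cvgV; first by rewrite gt_eqF// FG_gt0.
  by apply: cvgD; [exact: cF|exact: cG].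
have ch : {within `[0, 1], continuous h}.
  move/subspace_continuousP : csl => csl.
  apply/subspace_continuousP => z /= z01.
  have zc : 0 <= z <= 1 by rewrite in_itv/= in z01.
  apply: cvgB.
    apply: (@cvg_comp _ _ _ (simplex_coord F G) Z _ _ _ (csl _ z01)).
    exact: is_derive_continuous (dZ _ (sl_gt _ zc)).
  apply: cvgM; first exact: cvg_cst.
  exact: cvg_within.
have h0 (z : R) : 0 <= z <= 1 -> h z = 0.
  move=> /andP[z0 z1].
  have [x xz||c _] := @MVT_segment R h (fun=> 0) 0 z z0.
  - apply: dh; move: xz; rewrite in_itv/= => /andP[-> xz/=].
    exact: lt_le_trans z1.
  - apply: continuous_subspaceW ch; exact: subset_itvl.
  - rewrite mul0r => /eqP; rewrite subr_eq0 => /eqP ->.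
    by rewrite /h /simplex_coord F0 mul0r Z0 mulr0 subr0.
have CZ : C = Z 1.
  have h1 : h 1 = 0 by apply: h0; rewrite ler01 lexx.
  have [|_ G1 FG1] := FG 1; first by rewrite ler01 lexx.
  have {}G1 : G 1 = 0.
    move: FG1; rewrite F1 expr1n -[RHS]addr0 => /addrI/eqP.
    by rewrite expf_eq0 => /andP[_ /eqP].
  move/eqP: h1; rewrite /h /simplex_coord F1 G1 addr0 divr1 mulr1 subr_eq0.
  by move/eqP.
split=> // z zc; have [Fz Gz FGz] := FG _ zc.
rewrite -CZ; have /eqP := h0 _ zc; rewrite /h subr_eq0 => /eqP <-.
by rewrite SZ ?sl01// radial_simplex_coord.
Qed.

End Flow.

(** * A solution of the boundary value problem *)

Section Existence.
Variables (R : realType) (D : nat).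
Notation p := (D.+1).

Lemma radial_ge0 (s : R) : 0 <= s -> 0 <= radial D s.
Proof. by move=> s0; rewrite divr_ge0// ltW// pnorm_gt0. Qed.

Lemma radial_gt0 (s : R) : 0 < s -> 0 < radial D s.
Proof. by move=> s0; rewrite divr_gt0// pnorm_gt0. Qed.

Lemma radial_le1 (s : R) : 0 <= s <= 1 -> radial D s <= 1.
Proof.
move=> /andP[s0 s1]; rewrite -(@expr_le1 _ p)// ?radial_ge0//.
by rewrite -(radial_expD D s) lerDl exprn_ge0// radial_ge0// subr_ge0.
Qed.

Lemma radial_lt1 (s : R) : 0 <= s < 1 -> radial D s < 1.
Proof.
move=> /andP[s0 s1]; rewrite -(@expr_lt1 _ p)// ?radial_ge0//.
by rewrite -(radial_expD D s) ltrDl exprn_gt0// radial_gt0// subr_gt0.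
Qed.

(** The Caratheodory slope of the glued function is that of [f] on one side and
    0 on the other, hence still tends to 0. *)
Lemma is_derive_glue_cst (f : R -> R) (a b : R) :
  f a = b -> is_derive a 1 f 0 ->
  is_derive a 1 (fun z => if z < a then f z else b) 0.
Proof.
move=> fa /is_derive1_caratheodory[g [fg cg g0]].
apply/is_derive1_caratheodory.
exists (fun z => if z < a then g z else 0); split; last by rewrite ltxx.
  move=> z; rewrite ltxx.
  by case: ifP => _; [rewrite -fa fg|rewrite subrr mul0r].
rewrite /prop_for /continuous_at ltxx -g0; apply/cvgrPdist_lt => e e0.
have /cvgrPdist_lt/(_ e e0) := cg; apply: filterS => z.
by rewrite g0; case: ifP => // _ _; rewrite subrr normr0.
Qed.

(** The motion along the quarter curve with its speed scaled by [Z 1], so that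
    it takes unit time, continued by the value 1. *)
Definition quarter_wave (Z S : R -> R) (z : R) : R :=
  if z < 1 then radial D (S (Z 1 * z)) else 1.

(** The right-hand side of the equation equals [Z 1 * G ^+ D], where G is the
    second coordinate, and vanishes at the end point of the quarter curve when
    [D] is positive; this is why the continuation by 1 is differentiable. *)
Lemma quarter_wave_bvp Z S : (0 < D)%N -> clock D Z S ->
  bvp_solution D (Z 1) (quarter_wave Z S).
Proof.
move=> D0 [Z0 Z1 dZ SZ ZS].
pose H z := radial D (S (Z 1 * z)).
have arg (z : R) : 0 <= z <= 1 -> 0 <= Z 1 * z <= Z 1.
  by move=> /andP[z0 z1]; rewrite mulr_ge0 ?(ltW Z1)//= ler_piMr ?(ltW Z1).
have S01 (z : R) : 0 <= z <= 1 -> 0 <= S (Z 1 * z) <= 1.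
  by move=> /arg/ZS[].
have H_ge0 (z : R) : 0 <= z <= 1 -> 0 <= H z.
  by move=> /S01/andP[S0 _]; exact: radial_ge0.
have H_le1 (z : R) : 0 <= z <= 1 -> H z <= 1.
  by move=> /S01; exact: radial_le1.
have H0 : H 0 = 0.
  by rewrite /H mulr0 -[in S 0]Z0 SZ ?lexx ?ler01// radial0.
have H1 : H 1 = 1 by rewrite /H mulr1 SZ ?lexx ?ler01// radial1.
have H_lt1 (z : R) : 0 <= z < 1 -> H z < 1.
  move=> /andP[z0 z1]; have zc : 0 <= z <= 1 by rewrite z0 ltW.
  have /andP[s0 s1] := S01 _ zc; apply: radial_lt1.
  (* A clock time before Z 1 cannot correspond to the end point s = 1. *)
  rewrite s0 lt_neqAle s1 andbT; apply/eqP => s_eq1.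
  have [_ + _] := ZS _ (arg _ zc); rewrite s_eq1 => /eqP.
  by rewrite -[X in X == _]mulr1 (inj_eq (mulfI (lt0r_neq0 Z1))) gt_eqF.
have dH (z : R) : 0 <= z <= 1 ->
    is_derive z 1 H (Z 1 * (1 - H z ^+ p) `^ (D%:R / p%:R)).
  move=> zc; have [s01 _ dS] := ZS _ (arg _ zc).
  have /andP[_ s1] := s01.
  have dl := is_deriveZ (Z 1) (is_derive_id z (1 : R)).
  have := is_derive1_comp (is_derive_radial D _) (is_derive1_comp dS dl).
  move/is_derive_eq; apply.
  rewrite powR_fracE; last by rewrite subr_ge0 exprn_ile1// ?H_ge0// H_le1.
  have -> : 1 - H z ^+ p = radial D (1 - S (Z 1 * z)) ^+ p.
    by apply/eqP; rewrite subr_eq [eqbRHS]addrC; apply/eqP/esym/radial_expD.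
  rewrite exprSK ?radial_ge0 ?subr_ge0//.
  have N0 : pnorm D (S (Z 1 * z)) != 0 by rewrite gt_eqF// pnorm_gt0.
  rewrite /GRing.scale /=.
  by field.
pose Q := quarter_wave Z S.
have QH (z : R) : z <= 1 -> Q z = H z.
  rewrite le_eqVlt => /predU1P[->|z1]; last by rewrite /Q /quarter_wave z1.
  by rewrite H1 /Q /quarter_wave ltxx.
have Q1 (z : R) : 1 <= z -> Q z = 1.
  by rewrite /Q /quarter_wave leNgt => /negbTE ->.
have z01 : (0 : R) <= (0 : R) <= (1 : R) by rewrite lexx ler01.
have z11 : (0 : R) <= (1 : R) <= (1 : R) by rewrite lexx ler01.
have rhs1 : Z 1 * (1 - (1 : R) ^+ p) `^ (D%:R / p%:R) = 0.
  rewrite expr1n subrr powR0 ?mulr0//.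
  by rewrite mulf_neq0 ?invr_eq0 ?pnatr_eq0// -lt0n.
have dQ (z : R) : 0 < z ->
    is_derive z 1 Q (Z 1 * (1 - Q z ^+ p) `^ (D%:R / p%:R)).
  move=> z0; have [z1|z1|->] := ltgtP z 1.
  - rewrite QH ?ltW//; apply: near_eq_is_derive (dH z _); last by rewrite !ltW.
    by near=> y; rewrite QH// ltW//; near: y; exact: lt_nbhsl.
  - rewrite Q1 ?ltW// rhs1.
    apply: near_eq_is_derive (is_derive_cst (1 : R) z 1).
    by near=> y; rewrite Q1// ltW//; near: y; exact: lt_nbhsr.
  - rewrite Q1// rhs1; apply: is_derive_glue_cst => //.
    by have := dH _ z11; rewrite H1 rhs1.
split; split.
- move=> z z0; rewrite -/(Q z); have [z1|/ltW/Q1 ->] := leP z 1.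
    by rewrite QH// H_ge0 ?z0// H_le1 ?z0.
  by rewrite ler01 lexx.
- apply: continuous_in_subspaceT => z; rewrite inE/= in_itv/= andbT.
  rewrite le_eqVlt => /predU1P[<-|z0]; last first.
    exact: is_derive_continuous (dQ _ z0).
  apply: is_derive_continuous; apply: near_eq_is_derive (dH 0 z01).
  near=> y; rewrite -/(Q y) QH// ltW//.
  by near: y; apply: lt_nbhsl; exact: ltr01.
- move=> z z0; have [dz <-] := dQ z z0; split; first exact: dz.
  by rewrite derive1E.
- by rewrite -/(Q 0) QH.
- apply/eqP; rewrite eq_le; apply/andP; split.
    by apply: ereal_inf_lbound; exists 1 => //; split=> //; exact: Q1.
  apply: le_ereal_inf_tmp => _ [t [t0 Qt] <-]; rewrite lee_fin leNgt.
  apply/negP => t1; have := H_lt1 t; rewrite t1 ltW// => /(_ isT).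
  by rewrite -QH ?ltW// [Q t]Qt ltxx.
Unshelve. all: by end_near. Qed.

End Existence.

(** * Every solution of the boundary value problem moves along the curve *)

Section BVPUnique.
Variables (R : realType) (D : nat).
Notation p := (D.+1).

(** For positive [D] the derivative of the root blows up at 0, so continuity
    there needs its own argument. It is one-sided, since [powR] takes the value
    1 on negative reals. *)
Lemma cvg_rootS (T : Type) (L : set_system T) {FL : Filter L} (f : T -> R)
    (l : R) :
  0 <= l -> (\forall x \near L, 0 <= f x) -> f @ L --> l ->
  (fun x => rootS D (f x)) @ L --> rootS D l.
Proof.
rewrite le_eqVlt => /predU1P[<- f0 fl|l0 _ fl]; last first.
  apply: (@cvg_comp _ _ _ f (rootS D) _ _ _ fl).
  apply: is_derive_continuous (@is_derive_rootS R D id l 1 l0 _).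
have rootS0 : rootS D (0 : R) = 0 by rewrite /rootS powR0// invr_eq0 pnatr_eq0.
rewrite rootS0; apply/cvgr0Pnorm_lt => e e0.
have ep0 : 0 < e ^+ p by rewrite exprn_gt0.
near=> x; have fx0 : 0 <= f x by near: x.
rewrite ger0_norm ?rootS_ge0// -(@ltr_pXn2r _ p)// ?nnegrE ?rootS_ge0 ?ltW//.
by rewrite rootSK//; near: x; exact: (cvgr_lt _ fl).
Unshelve. all: by end_near. Qed.

(** The infimum condition means F < 1 before time 1 and, by continuity, F = 1 at
    time 1. As F is nondecreasing and bounded by 1, it is constant from then
    on. Before time 1 the function G = (1 - F^p)^(1/p) is positive, hence
    differentiable, and (F, G) moves along the curve. *)
Lemma bvp_eq_quarter_wave (c : R) (F : R -> R) Z S :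
    0 < c -> bvp_solution D c F -> clock D Z S ->
  c = Z 1 /\ forall z : R, 0 <= z -> F z = quarter_wave D Z S z.
Proof.
move=> c0 [[F01 cF dF] [F0 infF]] clk.
have F_ge0 (z : R) : 0 <= z -> 0 <= F z by move=> /F01/andP[].
have F_le1 (z : R) : 0 <= z -> F z <= 1 by move=> /F01/andP[].
have Fneq1 (z : R) : 0 < z < 1 -> F z < 1.
  move=> /andP[z0 z1]; rewrite lt_neqAle F_le1 ?ltW// andbT; apply/eqP => Fz.
  suff : (1 <= z%:E)%E by rewrite lee_fin leNgt z1.
  by rewrite -infF; apply: ereal_inf_lbound; exists z.
have F1 : F 1 = 1.
  apply/eqP; rewrite eq_le F_le1//=; rewrite leNgt; apply/negP => F1.
  have [dF1 _] := dF 1 ltr01.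
  have cF1 : {for 1, continuous F}.
    exact/differentiable_continuous/derivable1_diffP.
  have /nbhs_ballP[e /= e0 Fe] : \forall z \near (1 : R), F z < 1.
    exact: (cvgr_lt _ cF1).
  have [_ [t [t0 Ft] <-]] :
      exists2 y, [set t%:E | t in [set t | 0 < t /\ F t = 1]] y &
                 (y < (1 + e)%:E)%E.
    by apply: ereal_inf_lt; rewrite infF lte_fin ltrDl.
  rewrite lte_fin => te.
  have t1 : 1 <= t.
    rewrite leNgt; apply/negP => t1.
    by have := Fneq1 t; rewrite t0 t1 Ft ltxx => /(_ isT).
  have := Fe t; rewrite Ft ltxx /ball/= ler0_norm ?subr_le0// opprB ltrBlDl.
  by move=> /(_ te).
have Fge1 (z : R) : 1 <= z -> F z = 1.
  move=> z1; apply/eqP; rewrite eq_le F_le1 ?(le_trans ler01)//= -F1.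
  apply: (@ger0_derive1_ndecr R F 0 z) => //.
  - by move=> x; rewrite in_itv/= => /andP[/dF[]].
  - move=> x; rewrite in_itv/= => /andP[/dF[_ ->] _].
    by rewrite mulr_ge0 ?powR_ge0// ltW.
  - apply: continuous_subspaceW cF => x /=.
    by rewrite !in_itv/= andbT => /andP[].
pose G z := rootS D (1 - F z ^+ p).
have FG1 (z : R) : 0 <= z -> G z ^+ p = 1 - F z ^+ p.
  by move=> z0; rewrite rootSK// subr_ge0 exprn_ile1 ?F_ge0 ?F_le1.
have dF' (z : R) : 0 < z < 1 -> is_derive z 1 F (c * G z ^+ D).
  move=> /andP[z0 _]; have [dz F'z] := dF z z0.
  apply: DeriveDef; first exact: dz.
  by rewrite -derive1E F'z powR_fracE// subr_ge0 exprn_ile1 ?F_ge0 ?F_le1 ?ltW.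
have cF01 : {within `[0, 1], continuous F}.
  by apply: continuous_subspaceW cF => x /=; rewrite !in_itv/= andbT => /andP[].
have cG : {within `[0, 1], continuous G}.
  apply/subspace_continuousP => x /= x01.
  have x0 : 0 <= x by move: x01; rewrite in_itv/= => /andP[].
  apply: cvg_rootS.
  + by rewrite subr_ge0 exprn_ile1 ?F_ge0 ?F_le1.
  + apply: filterS (withinT _ _) => y; rewrite /= in_itv/= => /andP[y0 _].
    by rewrite subr_ge0 exprn_ile1 ?F_ge0 ?F_le1.
  + apply: cvgB; first exact: cvg_cst.
    apply: (@cvg_comp _ _ _ F (fun x => x ^+ p) _ (nbhs (F x))).
      move/subspace_continuousP : cF01; exact.
    exact: exprn_continuous.
have FG (z : R) : 0 <= z <= 1 ->
    [/\ 0 <= F z, 0 <= G z & F z ^+ p + G z ^+ p = 1].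
  move=> /andP[z0 z1]; split; [exact: F_ge0|exact: rootS_ge0|].
  by rewrite FG1// subrKC.
have dG (z : R) : 0 < z < 1 -> is_derive z 1 G (- (c * F z ^+ D)).
  move=> zo; have /andP[z0 z1] := zo.
  have Fp_lt1 : 0 < 1 - F z ^+ p.
    by rewrite subr_gt0 exprn_ilt1 ?F_ge0 ?Fneq1 ?ltW.
  have dm := is_deriveB (is_derive_cst (1 : R) z (1 : R))
                        (is_deriveX p (dF' _ zo)).
  have GE : G = fun y => rootS D ((cst 1 - F ^+ p) y).
    by apply/funext => y; rewrite !fctE.
  have Gz_gt0 : 0 < (cst 1 - F ^+ p) z by rewrite !fctE.
  rewrite [X in is_derive z 1 X _]GE.
  apply: (is_derive_eq (is_derive_rootS D Gz_gt0 dm)).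
  have G0 : G z != 0 by rewrite gt_eqF// rootS_gt0.
  have p0 : p%:R != 0 :> R by rewrite pnatr_eq0.
  rewrite /GRing.scale /= !fctE -/(G z).
  by field; rewrite addrC natr1 p0 expf_neq0.
have [cZ FE] := flow_unique clk cF01 cG FG dF' dG F0 F1.
split=> // z z0; rewrite /quarter_wave; have [z1|/Fge1//] := ltP z 1.
by apply: FE; rewrite z0 ltW.
Qed.

End BVPUnique.

(** * The recursion operator of the hardcore model *)

Section Limit.
Variables (R : realType) (D : nat).
Implicit Types f g : R -> R.

(** Distribution functions matter on [0, 1] only; composing with the
    projection to [0, 1] turns continuity there into continuity on the line,
    so that primitives can be taken globally. *)
Definition clip (z : R) : R := if z < 0 then 0 else if 1 < z then 1 else z.

Lemma clip01 z : 0 <= clip z <= 1.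
Proof.
rewrite /clip; have [z0|z0] := ltP z 0; first by rewrite lexx ler01.
by have [z1|z1] := ltP 1 z; rewrite ?ler01 ?lexx// z0 z1.
Qed.

Lemma clip_id z : 0 <= z <= 1 -> clip z = z.
Proof. by rewrite /clip => /andP[z0 z1]; rewrite !ltNge z0 z1. Qed.

Lemma clip_dist x y : `|clip x - clip y| <= `|x - y|.
Proof.
rewrite /clip ler_norml; have := ler_norm (x - y).
have := ler_norm (y - x); rewrite distrC.
case: ltP => ?; [|case: ltP => ?]; (case: ltP => ?; [|case: ltP => ?]);
  move=> ? ?; lra.
Qed.

Lemma clip_continuous : continuous clip.
Proof.
move=> z; apply/cvgrPdist_lt => e e0; near=> y.
apply: (le_lt_trans (clip_dist _ _)).
by near: y; apply: cvgr_dist_lt.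
Unshelve. all: by end_near. Qed.

Lemma dist_expr_le1 n (a b : R) : 0 <= a <= 1 -> 0 <= b <= 1 ->
  `|a ^+ n - b ^+ n| <= n%:R * `|a - b|.
Proof.
move=> /andP[a0 a1] /andP[b0 b1]; elim: n => [|n IH].
  by rewrite !expr0 subrr normr0 mul0r.
have -> : a ^+ n.+1 - b ^+ n.+1 = a * (a ^+ n - b ^+ n) + (a - b) * b ^+ n.
  by rewrite !exprS; ring.
rewrite (le_trans (ler_normD _ _))// -natr1 [leRHS]mulrDl mul1r lerD//.
  by rewrite normrM (ger0_norm a0) (le_trans _ IH)// ler_piMl.
by rewrite normrM ler_piMr// ger0_norm ?exprn_ge0// exprn_ile1.
Qed.

(** Up to normalisation, the density of the root spin at [t] when each of the
    [D] children independently has distribution function [g]: all of them must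
    be at most [1 - t]. *)
Definition child_weight g (t : R) : R := g (clip (1 - t)) ^+ D.

Definition cum_weight g (z : R) : R :=
  primitive (child_weight g) z - primitive (child_weight g) 0.

Definition cdf01 g : Prop :=
  [/\ continuous (g \o clip),
      forall z : R, 0 <= z <= 1 -> 0 <= g z <= 1 & g 1 = 1].

Lemma child_weight_continuous g :
  continuous (g \o clip) -> continuous (child_weight g).
Proof.
move=> cg z.
have -> : child_weight g =
    (fun x => x ^+ D) \o ((g \o clip) \o (fun t : R => 1 - t)) by [].
apply: continuous_comp; last exact: exprn_continuous.
apply: continuous_comp; last exact: cg.
by apply: continuousB; [exact: cst_continuous|exact: cvg_id].
Qed.

Lemma is_derive_cum_weight g (z : R) : continuous (g \o clip) -> -1 < z ->
  is_derive z 1 (cum_weight g) (child_weight g z).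
Proof.
move=> cg z1; have d := is_derive_primitive (child_weight_continuous cg) z1.
have /= := @is_deriveB _ _ _ _ _ _ _ _ _ d
  (is_derive_cst (primitive (child_weight g) 0) z 1).
by rewrite subr0.
Qed.

Lemma cum_weight0 g : cum_weight g 0 = 0.
Proof. by rewrite /cum_weight subrr. Qed.

Lemma cum_weight_MVT g (x y : R) : continuous (g \o clip) -> 0 <= x < y ->
  exists2 t, x < t < y &
    cum_weight g y - cum_weight g x = child_weight g t * (y - x).
Proof.
move=> cg /andP[x0 xy].
have gt1 (t : R) : x <= t -> -1 < t.
  by move=> xt; rewrite (lt_le_trans _ (le_trans x0 xt))// ltrN10.
have [t| |t] := @MVT R (cum_weight g) (child_weight g) x y xy.
- by rewrite in_itv/= => /andP[/ltW/gt1 t1 _]; exact: is_derive_cum_weight.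
- apply: continuous_in_subspaceT => t.
  rewrite inE/= in_itv/= => /andP[/gt1 t1 _].
  exact: is_derive_continuous (is_derive_cum_weight cg t1).
- by rewrite in_itv/= => txy ->; exists t.
Qed.

Lemma child_weight01 g t : cdf01 g -> 0 <= child_weight g t <= 1.
Proof.
move=> [_ g01 _]; have /andP[g0 g1] := g01 _ (clip01 (1 - t)).
by rewrite /child_weight exprn_ge0// exprn_ile1.
Qed.

Lemma cum_weight_le g (x y : R) :
  cdf01 g -> 0 <= x <= y -> cum_weight g x <= cum_weight g y.
Proof.
move=> gP /andP[x0]; rewrite le_eqVlt => /predU1P[->//|xy].
have [cg _ _] := gP.
have [|t _ cumE] := @cum_weight_MVT g x y cg; first by rewrite x0.
rewrite -subr_ge0 cumE mulr_ge0 ?subr_ge0 ?(ltW xy)//.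
by have /andP[] := child_weight01 t gP.
Qed.

(** Small root spins have weight close to g(1)^D = 1, so the normalisation never
    degenerates. The limit is covered too, being a uniform limit of such
    functions. *)
Lemma cum_weight1_gt0 g : cdf01 g -> 0 < cum_weight g 1.
Proof.
move=> gP; have [cg _ g1] := gP.
have k0 : child_weight g 0 = 1.
  by rewrite /child_weight subr0 clip_id ?g1 ?expr1n// ler01 lexx.
have k_gt0 : \forall t \near (0 : R), 0 < child_weight g t.
  by apply: (cvgr_gt _ (child_weight_continuous cg (x := 0))); rewrite k0 ltr01.
have [e /= e0 ke] := (nbhs_ballP _ _).1 k_gt0.
pose d := Num.min e 1.
have d0 : 0 < d by rewrite lt_min e0 ltr01.
have [|t /andP[t0 td]] := @cum_weight_MVT g 0 d cg; first by rewrite lexx d0.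
rewrite cum_weight0 !subr0 => cumE.
apply: (@lt_le_trans _ _ (cum_weight g d)).
  rewrite cumE mulr_gt0//; apply: ke.
  by rewrite /ball/= sub0r normrN gtr0_norm// (lt_le_trans td)// ge_min lexx.
by apply: cum_weight_le => //; rewrite ltW//= ge_min lexx orbT.
Qed.

(** The recursion operator is Lipschitz for the uniform distance before
    normalisation, since x^D has Lipschitz constant D on [0, 1]. *)
Lemma cum_weight_dist f g (e z : R) : cdf01 f -> cdf01 g -> 0 <= z <= 1 ->
  (forall y : R, 0 <= y <= 1 -> `|f y - g y| <= e) ->
  `|cum_weight f z - cum_weight g z| <= D%:R * e.
Proof.
move=> fP gP /andP[z0 z1] fge.
have [cf f01 _] := fP; have [cg g01 _] := gP.
have e0 : 0 <= e by apply: le_trans (fge 0 _); rewrite ?lexx ?ler01.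
have De0 : 0 <= D%:R * e by rewrite mulr_ge0.
have gt1 (t : R) : 0 <= t -> -1 < t.
  by move=> t0; rewrite (lt_le_trans _ t0)// ltrN10.
pose delta (t : R) := child_weight f t - child_weight g t.
have d (t : R) : -1 < t ->
    is_derive t 1 (cum_weight f - cum_weight g) (delta t).
  by move=> t1; apply: is_deriveB; exact: is_derive_cum_weight.
have [t||t _] := @MVT_segment R (cum_weight f - cum_weight g) delta 0 z z0.
- by rewrite in_itv/= => /andP[/ltW/gt1 t1 _]; exact: d.
- apply: continuous_in_subspaceT => t.
  rewrite inE/= in_itv/= => /andP[/gt1 t1 _].
  exact: is_derive_continuous (d _ t1).
rewrite !fctE !cum_weight0 !subr0 => ->; rewrite normrM (ger0_norm z0).
apply: le_trans (_ : D%:R * e * z <= _); last by rewrite ler_piMr.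
rewrite ler_wpM2r// (le_trans (dist_expr_le1 _ _ _))//; first exact/f01/clip01.
  exact/g01/clip01.
by rewrite ler_wpM2l// fge// clip01.
Qed.

End Limit.

(** * The limiting root marginal *)

Section RootCdf.
Variables (R : realType) (D : nat).
Notation p := (D.+1).

Lemma Rintegral_nu1 (f : R -> R) (z : R) : z <= 1 ->
  \int[nu1 R]_(t in `[0, z]) f t = \int[lebesgue_measure]_(t in `[0, z]) f t.
Proof.
move=> z1; congr fine; apply: eq_measure_integral => A _ Az.
rewrite /nu1 /= /mrestr setIidl//; apply: subset_trans Az _.
exact: subset_itvl.
Qed.

(** The root marginal with all leaf spins equal to 0. The zero configuration
    restricts to the zero configuration of each subtree, so these functions
    satisfy a recursion among themselves. *)
Definition free_cdf n : R -> R :=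
  root_cdf (nu1 R) ((fun=> 0) : leaf_spins R D n.+1).

Lemma free_cdf0 (z : R) : 0 <= z <= 1 -> free_cdf 0 z = z.
Proof.
move=> /andP[z0 z1]; rewrite /free_cdf /= /root_cdf1.
have -> : \big[Num.max/0]_(i < D) (0 : R) = 0.
  by elim/big_ind: _ => // x y -> ->; rewrite maxxx.
rewrite ltr01 subr0 min_l//.
have nu (y : R) : 0 <= y <= 1 -> fine (nu1 R `[0, y]%classic) = y.
  move=> /andP[y0 y1]; rewrite /nu1 /= /mrestr setIidl; last exact: subset_itvl.
  rewrite lebesgue_measure_itv /= lte_fin; case: ltP => [_|y0'] /=.
    by rewrite subr0.
  by apply/eqP; rewrite eq_le y0 y0'.
by rewrite !nu ?z0 ?ler01 ?lexx// divr1.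
Qed.

Lemma free_cdfS n (z : R) : continuous (free_cdf n \o @clip R) -> 0 <= z <= 1 ->
  free_cdf n.+1 z =
    cum_weight D (free_cdf n) z / cum_weight D (free_cdf n) 1.
Proof.
move=> cu zc.
have E (y : R) : 0 <= y <= 1 ->
    \int[nu1 R]_(t in `[0, y]) \prod_(i < D) free_cdf n (1 - t) =
    cum_weight D (free_cdf n) y.
  move=> /andP[y0 y1]; rewrite Rintegral_nu1//.
  rewrite /cum_weight -Rintegral_primitive//; last first.
    exact: child_weight_continuous.
  apply: eq_Rintegral => t; rewrite inE/= in_itv/= => /andP[t0 ty].
  rewrite prodr_const card_ord /child_weight clip_id//.
  by rewrite subr_ge0 (le_trans ty)//= gerBl.
by rewrite -!E// ?ler01 ?lexx.
Qed.

Lemma free_cdf01 n : cdf01 (free_cdf n).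
Proof.
elim: n => [|n IH].
  split.
  - have -> : free_cdf 0 \o @clip R = @clip R.
      by apply/funext => z /=; rewrite free_cdf0// clip01.
    exact: clip_continuous.
  - by move=> z zc; rewrite free_cdf0.
  - by rewrite free_cdf0// ler01 lexx.
have [cu u01 u1] := IH.
have V0 := cum_weight1_gt0 D IH.
split.
- have -> : free_cdf n.+1 \o @clip R =
      (fun y => cum_weight D (free_cdf n) y *
                (cum_weight D (free_cdf n) 1)^-1) \o @clip R.
    by apply/funext => z /=; rewrite free_cdfS// clip01.
  move=> z; apply: continuous_comp; first exact: clip_continuous.
  apply: continuousM; last exact: cst_continuous.
  apply: is_derive_continuous (is_derive_cum_weight D cu _).
  by have /andP[z0 _] := clip01 z; rewrite (lt_le_trans _ z0)// ltrN10.
- move=> z zc; have /andP[z0 z1] := zc; rewrite free_cdfS//.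
  rewrite ler_pdivrMr// mul1r divr_ge0 ?(ltW V0)//=.
    by apply: cum_weight_le => //; rewrite z0.
  rewrite -(cum_weight0 D (free_cdf n)).
  by apply: cum_weight_le => //; rewrite lexx.
- by rewrite free_cdfS ?ler01 ?lexx// divff// gt_eqF.
Qed.

Lemma limit_unif (F : R -> R) (e : R) : is_limit_root_cdf D F -> 0 < e ->
  \forall n \near \oo,
    forall z : R, 0 <= z <= 1 -> `|free_cdf n z - F z| <= e.
Proof.
move=> [cvF _] e0.
have lt_e : nbhs (0 : \bar R) [set y | (y < e%:E)%E].
  apply: open_nbhs_nbhs; split; first exact: open_ereal_lt_ereal.
  by rewrite /= lte_fin.
have [N _ sup_lt] := cvF _ lt_e.
exists N => // n /= Nn z zc.
have := sup_lt n.+1 (leqW Nn); rewrite /= => /ltW/(le_trans _) le_e.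
rewrite -lee_fin; apply: le_e.
apply: le_ereal_sup_tmp; eexists.
  by exists (fun=> 0) => //= q; rewrite lexx ler01.
by apply: ereal_sup_ubound; exists z => //=; rewrite in_itv.
Qed.

Variable F : R -> R.
Hypothesis limF : is_limit_root_cdf D F.

Lemma limit_cvg (z : R) : 0 <= z <= 1 -> (fun n => free_cdf n z) @ \oo --> F z.
Proof.
move=> zc; apply/cvgrPdist_le => e e0.
by apply: filterS (limit_unif limF e0) => n; rewrite distrC; exact.
Qed.

Lemma limit_cdf01 : cdf01 F.
Proof.
split.
- move=> x; apply/cvgrPdist_le => e e0.
  have e3 : 0 < e / 3 by rewrite divr_gt0.
  have [N _ /(_ N (leqnn N)) uF] := limit_unif limF e3.
  have [cu _ _] := free_cdf01 N.
  have /cvgrPdist_le/(_ _ e3) := cu x; apply: filterS => y /= uxy.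
  have := uF _ (clip01 x); have := uF _ (clip01 y); move: uxy.
  rewrite !ler_norml; lra.
- move=> z zc; apply/andP; split.
    apply: cvgr_to_ge (limit_cvg zc) _; apply: nearW => n.
    by have [_ /(_ z zc) /andP[]] := free_cdf01 n.
  apply: cvgr_to_le (limit_cvg zc) _; apply: nearW => n.
  by have [_ /(_ z zc) /andP[]] := free_cdf01 n.
- apply: (cvg_unique _ (limit_cvg _)) => //; rewrite ?ler01 ?lexx//.
  apply: cvg_near_cst; apply: nearW => n.
  by have [_ _ ->] := free_cdf01 n.
Qed.

Lemma limit_cum_weight_cvg (z : R) : 0 <= z <= 1 ->
  (fun n => cum_weight D (free_cdf n) z) @ \oo --> cum_weight D F z.
Proof.
move=> zc; apply/cvgrPdist_le => e e0.
(* Dividing by p = D + 1 rather than by D covers D = 0. *)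
have eD : 0 < e / p%:R by rewrite divr_gt0.
apply: filterS (limit_unif limF eD) => n uF.
rewrite distrC.
rewrite (le_trans (cum_weight_dist D (free_cdf01 n) limit_cdf01 zc uF))//.
by rewrite mulrCA ger_pMr// ler_pdivrMr// mul1r ler_nat.
Qed.

(** Numerators and denominators of the recursion converge separately, and the
    limiting denominator is positive. *)
Lemma limit_fixpoint (z : R) :
  0 <= z <= 1 -> F z = cum_weight D F z / cum_weight D F 1.
Proof.
move=> zc; have o1 : 0 <= (1 : R) <= (1 : R) by rewrite ler01 lexx.
have V0 := cum_weight1_gt0 D limit_cdf01.
have cV : (fun n => free_cdf n.+1 z) @ \oo -->
    cum_weight D F z / cum_weight D F 1.
  have -> : (fun n => free_cdf n.+1 z) =
      (fun n => cum_weight D (free_cdf n) z *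
                (cum_weight D (free_cdf n) 1)^-1).
    by apply/funext => n; rewrite free_cdfS//; have [] := free_cdf01 n.
  apply: cvgM; first exact: limit_cum_weight_cvg.
  by apply: cvgV; [rewrite gt_eqF|exact: limit_cum_weight_cvg].
apply: cvg_unique cV => //.
by have := limit_cvg zc; rewrite -(cvg_shiftS (fun n => free_cdf n z)).
Qed.

(** The fixed-point equation gives F'(z) = c F(1-z)^D with c the inverse of the
    normalisation. Replacing z by 1 - z shows that F(z) and G(z) = F(1-z)
    solve the same system as the coordinates of a solution of the boundary
    value problem. *)
Lemma limit_eq_quarter_wave Z S : clock D Z S ->
  forall z : R, 0 <= z -> F z = quarter_wave D Z S z.
Proof.
move=> clk; have [_ F_ge1] := limF.
have [cF F01 F1] := limit_cdf01.
pose c := (cum_weight D F 1)^-1; pose G (z : R) := F (1 - z).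
have o0 : 0 <= (0 : R) <= (1 : R) by rewrite ler01 lexx.
have onem (z : R) : 0 <= z <= 1 -> 0 <= 1 - z <= 1.
  by move=> /andP[z0 z1]; rewrite subr_ge0 z1 gerBl.
have onemo (z : R) : 0 < z < 1 -> 0 < 1 - z < 1.
  by move=> /andP[z0 z1]; rewrite subr_gt0 z1 gtrBl.
have oc (z : R) : 0 < z < 1 -> 0 <= z <= 1 by move=> /andP[/ltW-> /ltW->].
have F0 : F 0 = 0 by rewrite limit_fixpoint// cum_weight0 mul0r.
have dF (z : R) : 0 < z < 1 -> is_derive z 1 F (c * G z ^+ D).
  move=> zo; have zc := oc _ zo; have /andP[z0 z1] := zo.
  have zN1 : -1 < z by rewrite (lt_trans _ z0)// ltrN10.
  have d := is_deriveZ c (is_derive_cum_weight D cF zN1).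
  have -> : c * G z ^+ D = c *: child_weight D F z.
    by rewrite /child_weight clip_id// onem.
  apply: near_eq_is_derive d; near=> y.
  have yc : 0 <= y <= 1.
    apply/andP; split; apply: ltW; near: y; [exact: lt_nbhsr|exact: lt_nbhsl].
  by rewrite limit_fixpoint// mulrC.
have dG (z : R) : 0 < z < 1 -> is_derive z 1 G (- (c * F z ^+ D)).
  move=> zo.
  have d := is_deriveB (is_derive_cst (1 : R) z (1 : R))
                       (is_derive_id z (1 : R)).
  have dc := @is_derive1_comp _ F _ z _ _ (dF _ (onemo _ zo)) d.
  by apply: (is_derive_eq dc); rewrite /G subKr sub0r mulrN1.
have cF01 : {within `[0, 1], continuous F}.
  apply: (@subspace_eq_continuous _ _ _ (F \o @clip R)).
    by move=> z; rewrite inE/= in_itv/= => zc; rewrite clip_id.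
  exact: continuous_subspaceT.
have cG01 : {within `[0, 1], continuous G}.
  apply: (@subspace_eq_continuous _ _ _
            ((F \o @clip R) \o (fun z : R => 1 - z))).
    by move=> z; rewrite inE/= in_itv/= => zc; rewrite /= clip_id// onem.
  apply: continuous_subspaceT => z; apply: continuous_comp; last exact: cF.
  by apply: continuousB; [exact: cst_continuous|exact: cvg_id].
(* Conserved by the system, with value F(0)^p + F(1)^p = 1 at z = 0. *)
pose E (z : R) := F z ^+ p + G z ^+ p.
have dE (z : R) : 0 < z < 1 -> is_derive z 1 E 0.
  move=> zo.
  have d := is_deriveD (is_deriveX p (dF _ zo)) (is_deriveX p (dG _ zo)).
  have -> : E = F ^+ p + G ^+ p by apply/funext => y; rewrite !fctE.
  apply: (is_derive_eq d); rewrite /GRing.scale /=.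
  by ring.
have cE : {within `[0, 1], continuous E}.
  move/subspace_continuousP : cF01 => cF'.
  move/subspace_continuousP : cG01 => cG'.
  apply/subspace_continuousP => z z01; apply: cvgD.
    apply: (@cvg_comp _ _ _ F (fun x => x ^+ p) _ (nbhs (F z)) _
              (cF' _ z01)).
    exact: exprn_continuous.
  apply: (@cvg_comp _ _ _ G (fun x => x ^+ p) _ (nbhs (G z)) _
            (cG' _ z01)).
  exact: exprn_continuous.
have FG (z : R) : 0 <= z <= 1 ->
    [/\ 0 <= F z, 0 <= G z & F z ^+ p + G z ^+ p = 1].
  move=> zc; split.
  - by have /andP[] := F01 _ zc.
  - by have /andP[] := F01 _ (onem _ zc).
  have /andP[z0 z1] := zc.
  have [x xz||t _] := @MVT_segment R E (fun=> 0) 0 z z0.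
  - apply: dE; move: xz; rewrite in_itv/= => /andP[-> xz/=].
    exact: lt_le_trans z1.
  - by apply: continuous_subspaceW cE; exact: subset_itvl.
  - rewrite mul0r => /eqP; rewrite subr_eq0 -/(E z) => /eqP ->.
    by rewrite /E /G subr0 F0 F1 expr0n expr1n add0r.
have [_ FE] := flow_unique clk cF01 cG01 FG dF dG F0 F1.
move=> z z0; rewrite /quarter_wave; have [z1|/F_ge1//] := ltP z 1.
by apply: FE; rewrite z0 ltW.
Unshelve. all: by end_near. Qed.

End RootCdf.

(** * The boundary value problem and the hardcore model *)

Theorem theorem3p3 (R : realType) (Delta : nat) (hDelta : (1 <= Delta)%N) :
  exists C : R,
    unique (fun c : R => 0 < c /\ exists F : R -> R, bvp_solution Delta c F) C
    /\ exists Fbar : R -> R,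
      [/\ bvp_solution Delta C Fbar,
          forall G : R -> R, bvp_solution Delta C G ->
            forall z : R, 0 <= z -> G z = Fbar z &
          forall F : R -> R, is_limit_root_cdf Delta F ->
            forall z : R, 0 <= z -> Fbar z = F z].
Proof.
have [Z [S clk]] := clock_exists R Delta.
have [_ Z1 _ _ _] := clk.
have sol := quarter_wave_bvp hDelta clk.
exists (Z 1); split.
  split; first by split=> //; exists (quarter_wave Delta Z S).
  by move=> c [c0 [F /bvp_eq_quarter_wave/(_ clk)-/(_ c0)[]]].
exists (quarter_wave Delta Z S); split=> // [G solG|F limF] z z0.
  by have [_ ->] := bvp_eq_quarter_wave Z1 solG clk.
by rewrite (limit_eq_quarter_wave limF clk).
Qed.
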